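(* Let $n,p\ge 1$, and let $A\in\mathbb{R}^{n\times n}$, $B\in\mathbb{R}^{n\times 1}$, $C\in\mathbb{R}^{p\times n}$ with rows $C_1,\dots,C_p$, such that $(A,B)$ is controllable and $(C,A)$ is observable. Let $a(s)=\det(sI-A)$ and $d_i(s)=C_i\operatorname{adj}(sI-A)B$ for $i=1,\dots,p$, and define the set of real polynomials $$\mathcal S_{\rm SIMO}=\{s^ra(s):r=0,\ldots,n-1\}\cup\{s^rd_i(s):r=0,\ldots,n-1,\ i=1,\ldots,p\}.$$ Then there exists a vector $v=(v_1,\dots,v_p)^\top\in\mathbb{R}^p$ such that, with $\widetilde d(s)=\sum_{i=1}^p v_i d_i(s)$, $$\operatorname{span}\mathcal S_{\rm SIMO}=\operatorname{span}\{s^ra(s),\,s^r\widetilde d(s):r=0,\ldots,n-1\}.$$ Consequently, $\dim\operatorname{span}\mathcal S_{\rm SIMO}=2n$ (spans over $\mathbb{R}$). Equivalently, the complete SIMO filtered vector $z(t)=\operatorname{col}(\zeta_u(t),\zeta_{y_1}(t),\dots,\zeta_{y_p}(t))\in\mathbb{R}^{n(1+p)}$ has exactly $2n$ linearly independent components, i.e. the linear space spanned by its $n(1+p)$ scalar components has dimension $2n$.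
   Context: The plant is $\dot x=Ax+Bu$, $y=Cx$ with state $x(t)\in\mathbb{R}^n$, scalar input $u(t)$ and output $y(t)=(y_1(t),\dots,y_p(t))^\top\in\mathbb{R}^p$, so in the Laplace domain (zero initial conditions) $Y_i(s)=\frac{d_i(s)}{a(s)}U(s)$. Filtered variables: let $\Lambda(s)=s^n+\alpha_{n-1}s^{n-1}+\cdots+\alpha_0$ be a chosen real Hurwitz polynomial, $A_f\in\mathbb{R}^{n\times n}$ its companion matrix and $b_f=[0,\dots,0,1]^\top$, so that $(sI-A_f)^{-1}b_f=\frac{1}{\Lambda(s)}[1,s,\dots,s^{n-1}]^\top$. Define $\dot\zeta_u=A_f\zeta_u+b_fu$ and $\dot\zeta_{y_i}=A_f\zeta_{y_i}+b_fy_i$. In the Laplace domain the $(r+1)$th component of $\zeta_u$ is $s^rU(s)/\Lambda(s)$ and that of $\zeta_{y_i}$ is $s^rY_i(s)/\Lambda(s)=\frac{s^rd_i(s)}{a(s)\Lambda(s)}U(s)$, $r=0,\dots,n-1$. Convention: linear relations among scalar components of filtered vectors (spans, independence, dimension, over $\mathbb{R}$) are understood for their Laplace-domain representations with zero initial conditions, i.e. for their transfer functions from $u$. After multiplication by $a(s)\Lambda(s)$, the $(r+1)$th component of $\zeta_u$ corresponds to the polynomial $s^ra(s)$ and that of $\zeta_{y_i}$ to $s^rd_i(s)$. *)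

(* Defs.v *)
From HB Require Import structures.
From mathcomp Require Import all_boot all_order all_algebra.
From mathcomp Require Import complex.
From mathcomp Require Import all_classical all_reals all_analysis.

Set Implicit Arguments.
Unset Strict Implicit.
Unset Printing Implicit Defensive.

Import Order.TTheory GRing.Theory Num.Theory.
Import numFieldNormedType.Exports.

Local Open Scope classical_set_scope.
Local Open Scope ring_scope.

(* V may be infinite-dimensional, so the subspaces of [vectType] do not apply. *)

Definition lspan (K : fieldType) (V : lmodType K) (S : set V) : set V :=
  [set x | exists (m : nat) (c : 'I_m -> K) (e : 'I_m -> V),
     (forall i, S (e i)) /\ x = \sum_(i < m) c i *: e i].

Definition lin_indep (K : fieldType) (V : lmodType K) (k : nat)
    (e : 'I_k -> V) : Prop :=
  forall c : 'I_k -> K, \sum_(i < k) c i *: e i = 0 -> forall i, c i = 0.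

Definition has_dim (K : fieldType) (V : lmodType K) (W : set V) (k : nat)
  : Prop :=
  exists e : 'I_k -> V, lin_indep e /\ lspan (range e) = W.

(* x' = A x + B u on the whole real line.  For continuous u every solution
   extends to the whole line, so this does not restrict trajectories that are
   only considered on a bounded interval. *)
Definition trajectory (R : realType) (n : nat) (A : 'M[R]_n) (B : 'cV[R]_n)
    (u : R -> R) (x : R -> 'cV[R]_n) : Prop :=
  forall (t : R) (i : 'I_n),
    is_derive t (1 : R) (fun s => x s i 0) ((A *m x t + u t *: B) i 0).

Definition controllable (R : realType) (n : nat) (A : 'M[R]_n) (B : 'cV[R]_n)
  : Prop :=
  forall x0 x1 : 'cV[R]_n,
    exists (T : R) (u : R -> R) (x : R -> 'cV[R]_n),
      [/\ 0 < T, continuous u, trajectory A B u x, x 0 = x0 & x T = x1].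

(* Stated for the unforced system x' = A x, y = C x: a known input shifts all
   outputs by the same function, so it plays no role here. *)
Definition observable (R : realType) (n p : nat) (C : 'M[R]_(p, n))
    (A : 'M[R]_n) : Prop :=
  exists2 T : R, 0 < T &
    forall x x' : R -> 'cV[R]_n,
      trajectory A 0 (fun=> 0) x -> trajectory A 0 (fun=> 0) x' ->
      (forall t : R, 0 <= t <= T -> C *m x t = C *m x' t) ->
      x 0 = x' 0.

(* d_i(s) = C_i adj(sI - A) B; the denominator a(s) is [char_poly A]. *)
Definition dnum (R : realType) (n p : nat) (A : 'M[R]_n) (B : 'cV[R]_n)
    (C : 'M[R]_(p, n)) (i : 'I_p) : {poly R} :=
  (map_mx polyC (row i C) *m \adj (char_poly_mx A) *m map_mx polyC B) 0 0.

Definition S_SIMO (R : realType) (n p : nat) (A : 'M[R]_n) (B : 'cV[R]_n)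
    (C : 'M[R]_(p, n)) : set {poly R} :=
  [set q | exists r : 'I_n, q = 'X^r * char_poly A] `|`
  [set q | exists (r : 'I_n) (i : 'I_p), q = 'X^r * dnum A B C i].

(* An alias of the fraction field, so that it can carry a vector space structure
   over the field of constants. *)

Definition ratfun (R : fieldType) := {fraction {poly R}}.
HB.instance Definition _ (R : fieldType) := GRing.Field.on (ratfun R).

Definition ratpoly (R : fieldType) (q : {poly R}) : ratfun R := tofrac q.
HB.instance Definition _ (R : fieldType) :=
  GRing.RMorphism.copy (@ratpoly R) (@tofrac {poly R}).

Definition ratconst (R : fieldType) (c : R) : ratfun R := ratpoly c%:P.

Section RatfunLmod.
Variable R : fieldType.

Definition ratscale (c : R) (f : ratfun R) : ratfun R := ratconst c * f.

Lemma ratscaleA (c1 c2 : R) (f : ratfun R) :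
  ratscale c1 (ratscale c2 f) = ratscale (c1 * c2) f.
Proof. by rewrite /ratscale /ratconst mulrA polyCM rmorphM. Qed.

Lemma ratscale1 : left_id 1 ratscale.
Proof. by move=> f; rewrite /ratscale /ratconst rmorph1 mul1r. Qed.

Lemma ratscaleDr : right_distributive ratscale +%R.
Proof. by move=> c f g; rewrite /ratscale mulrDr. Qed.

Lemma ratscaleDl (f : ratfun R) : {morph ratscale^~ f : c1 c2 / c1 + c2}.
Proof. by move=> c1 c2; rewrite /ratscale /ratconst polyCD rmorphD mulrDl. Qed.

HB.instance Definition _ := GRing.Zmodule_isLmodule.Build R (ratfun R)
  ratscaleA ratscale1 ratscaleDr ratscaleDl.
End RatfunLmod.

(* C (sI - A)^-1 B, the transfer matrix of x' = A x + B u, y = C x with zero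
   initial state.  sI - A is invertible over the rational functions because
   its determinant is monic, so [invmx] is the genuine inverse. *)
Definition transfer (R : fieldType) (n m p : nat) (A : 'M[R]_n)
    (B : 'M[R]_(n, m)) (C : 'M[R]_(p, n)) : 'M[ratfun R]_(p, m) :=
  map_mx (@ratconst R) C *m invmx (map_mx (@ratpoly R) (char_poly_mx A))
    *m map_mx (@ratconst R) B.

Definition hurwitz (R : realType) (q : {poly R}) : Prop :=
  forall z : R[i]%C,
    root (map_poly (fun c : R => real_complex R c) q) z -> complex.Re z < 0.

(* Ones on the superdiagonal, last row -alpha_0, ..., -alpha_(n-1), where
   Lambda = X^n + alpha_(n-1) X^(n-1) + ... + alpha_0.  The dimension is an
   independent parameter, unlike that of [companionmx], which is a function of
   the size of the polynomial. *)
Definition filter_mx (R : realType) (n : nat) (Lambda : {poly R}) : 'M[R]_n :=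
  \matrix_(i < n, j < n)
    (if i.+1 == n :> nat then - Lambda`_j else (i.+1 == j :> nat)%:R).

Definition filter_in (R : realType) (n : nat) : 'cV[R]_n :=
  \col_(i < n) (i.+1 == n :> nat)%:R.

(* A signal driven by u from zero initial conditions is represented by its
   transfer function from u; the filter of zeta_(y_i) is in series with the
   plant. *)
Definition zeta_u (R : realType) (n : nat) (Lambda : {poly R})
  : 'cV[ratfun R]_n :=
  transfer (filter_mx n Lambda) (filter_in R n) 1%:M.

Definition zeta_y (R : realType) (n p : nat) (Lambda : {poly R})
    (A : 'M[R]_n) (B : 'cV[R]_n) (C : 'M[R]_(p, n)) (i : 'I_p)
  : 'cV[ratfun R]_n :=
  transfer A B C i 0 *: transfer (filter_mx n Lambda) (filter_in R n) 1%:M.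

Definition zvec (R : realType) (n p : nat) (Lambda : {poly R})
    (A : 'M[R]_n) (B : 'cV[R]_n) (C : 'M[R]_(p, n))
  : 'cV[ratfun R]_(n + \sum_(i < p) n) :=
  col_mx (zeta_u n Lambda) (\mxcol_(i < p) zeta_y Lambda A B C i).

(* Main.v *)
(** Put [b(s) = adj(sI - A) B], so that [(sI - A) b = a B] and [d_i = C_i b].
At a complex root [z] of [a] the vector [b(z)] satisfies [A b(z) = z b(z)].  If
all the [d_i] vanish at [z], then [C b(z) = 0], and comparing the trajectory
[Re (e^(z t) b(z))] with the zero one gives [b(z) = 0] by observability.  But the
[n] real coefficient vectors of [b] are independent: their span is
[A]-invariant and contains [B], so a row vector annihilating it would vanish
along every trajectory from [0], against controllability.  Hence
[a, d_1, ..., d_p] have no common root, and for all but finitely many [t] the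
combination [sum_i t^i d_i] is coprime to [a].  By Bezout the shifts of [a] and
of this combination span all polynomials of degree less than [2n], and this
space contains [S_SIMO].  Dividing by [a Lambda] gives the components of the
filtered vector. *)

Require Import Defs.
From HB Require Import structures.
From mathcomp Require Import all_boot all_order all_algebra.
From mathcomp Require Import complex.
From mathcomp Require Import all_classical all_reals all_analysis.
From mathcomp Require Import ring lra.

Set Implicit Arguments.
Unset Strict Implicit.
Unset Printing Implicit Defensive.

Import Order.TTheory GRing.Theory Num.Theory.
Import numFieldNormedType.Exports.

Local Open Scope classical_set_scope.
Local Open Scope ring_scope.

(** * Linear differential equations: uniqueness, controllability, observability *)

Lemma is_derive_mulmx (R : realType) (m n : nat) (K : 'M[R]_(m, n))
    (x : R -> 'cV[R]_n) (dx : 'cV[R]_n) (t : R) (i : 'I_m) :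
  (forall j, is_derive t (1 : R) (fun s => x s j 0) (dx j 0)) ->
  is_derive t (1 : R) (fun s => (K *m x s) i 0) ((K *m dx) i 0).
Proof.
move=> xd.
have -> : (fun s => (K *m x s) i 0)
    = \sum_(j < n) (K i j \*: (fun s => x s j 0 : R^o)).
  by apply/funext => s; rewrite mxE fct_sumE.
rewrite mxE; apply: is_derive_sum => j.
Qed.

(* Gronwall, applied to the squared norm of y. *)
Lemma linear_ode_zero (R : realType) (m : nat) (D : 'M[R]_m)
    (y : R -> 'cV[R]_m) :
  (forall t i, is_derive t (1 : R) (fun s => y s i 0) ((D *m y t) i 0)) ->
  y 0 = 0 -> forall T, 0 <= T -> y T = 0.
Proof.
move=> yd y0 T T0.
pose f : R -> R := \sum_(i < m) (fun s => y s i 0) ^+ 2.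
have fE (t : R) : f t = \sum_(i < m) y t i 0 ^+ 2 by rewrite /f fct_sumE.
have f_ge (t : R) i : y t i 0 ^+ 2 <= f t.
  by rewrite fE (bigD1 i)//= lerDl sumr_ge0// => j _; exact: sqr_ge0.
pose df (t : R) : R := \sum_(i < m) (2 * y t i 0 * (D *m y t) i 0).
have fd (t : R) : is_derive t (1 : R) f (df t).
  rewrite /f /df; apply: is_derive_sum .
(* Termwise, [|2 * y_i * y_j| <= y_i^2 + y_j^2 <= 2 * f], which explains the factor 2. *)
pose L : R := \sum_(i < m) \sum_(j < m) (`|D i j| * 2).
have dfL (t : R) : df t <= L * f t.
  rewrite /df /L mulr_suml ler_sum// => i _.
  rewrite mxE mulr_sumr mulr_suml ler_sum// => j _.
  apply: le_trans (ler_norm _) _.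
  have -> : 2 * y t i 0 * (D i j * y t j 0) = D i j * (2 * (y t i 0 * y t j 0)).
    by ring.
  rewrite normrM -mulrA ler_wpM2l//.
  have := f_ge t i; have := f_ge t j.
  by rewrite ler_norml => h1 h2; apply/andP; split; nra.
(* The integrating factor turns [df <= L * f] into [g' <= 0]; with [g 0 = 0] this forces
   [f T <= 0]. *)
pose g (t : R) : R := f t * expR (- L * t).
have gd (t : R) : is_derive t (1 : R) g ((df t - L * f t) * expR (- L * t)).
  have hl : is_derive t (1 : R) (fun s : R => - L * s) (- L).
    have := @is_deriveZ R R R id (- L) t 1 _ (is_derive_id t 1).
    by rewrite /GRing.scale/= mulr1.
  have he := is_derive1_comp (is_derive_expR (- L * t)) hl.
  have := @is_deriveM R R _ _ _ _ _ _ (fd t) he.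
  rewrite /GRing.scale/=; move=> h; apply: (is_derive_eq h); ring.
have g_noninc : g T <= g 0.
  apply: (@ler0_derive1_le_cc _ g 0 T); rewrite ?in_itv/=; rewrite ?T0 ?lexx//.
  - move=> t _; rewrite derive1E; have [_ ->] := gd t.
    by rewrite mulr_le0_ge0 ?expR_ge0// subr_le0.
  - apply: continuous_subspaceT => t.
    apply: differentiable_continuous; apply/derivable1_diffP.
    by have [] := gd t.
have fT : f T <= 0.
  have g0 : g 0 = 0.
    rewrite /g fE big1 ?mul0r// => i _.
    by rewrite y0 mxE expr0n.
  by move: g_noninc; rewrite g0 /g pmulr_lle0 ?expR_gt0.
apply/matrixP => i j; rewrite ord1 [RHS]mxE.
apply/eqP; rewrite -sqrf_eq0 eq_le sqr_ge0 andbT.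
exact: le_trans (f_ge T i) fT.
Qed.

(** Since [K *m B = 0] cancels the input, [y = K *m x] obeys y' = D y along every trajectory, so it
    stays 0 when x starts at 0. Controllability lets x reach each basis vector, and every column of
    [K] vanishes. *)
Lemma controllable_invariant (R : realType) (m n : nat) (A : 'M[R]_n)
    (B : 'cV[R]_n) (K : 'M[R]_(m, n)) (D : 'M[R]_m) :
  controllable A B -> K *m A = D *m K -> K *m B = 0 -> K = 0.
Proof.
move=> ctr KA KB; apply/matrixP => i j; rewrite [RHS]mxE.
have [T [u [x [T0 _ xt x0 xT]]]] := ctr 0 (delta_mx j 0).
have : (K *m x T) = 0.
  apply: (@linear_ode_zero R m D (fun t => K *m x t)) (ltW T0) => //.
    move=> t k.
    have -> : D *m (K *m x t) = K *m (A *m x t + u t *: B).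
      by rewrite mulmxDr -scalemxAr KB scaler0 addr0 !mulmxA KA.
    by apply: is_derive_mulmx => l; exact: xt.
  by rewrite x0 mulmx0.
by rewrite xT -colE => /matrixP/(_ i 0); rewrite !mxE.
Qed.

(** The hypotheses say that v + i w satisfies the eigenvector equation of A for sigma + i omega; the
    trajectory is the real part of e^((sigma + i omega) t) (v + i w). *)
Lemma trajectory_mode (R : realType) (n : nat) (A : 'M[R]_n) (v w : 'cV[R]_n)
    (sigma omega : R) :
  A *m v = sigma *: v - omega *: w -> A *m w = omega *: v + sigma *: w ->
  trajectory A 0 (fun=> 0) (fun t => expR (sigma * t) *:
    (cos (omega * t) *: v - sin (omega * t) *: w)).
Proof.
move=> Av Aw t i.
have hl (c : R) : is_derive t (1 : R) (fun s : R => c * s) c.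
  have := @is_deriveZ R R R id c t 1 _ (is_derive_id t 1).
  by rewrite /GRing.scale/= mulr1.
have he := is_derive1_comp (is_derive_expR _) (hl sigma).
have hc := is_derive1_comp (is_derive_cos _) (hl omega).
have hs := is_derive1_comp (is_derive_sin _) (hl omega).
have h : is_derive t (1 : R)
    (fun s => expR (sigma * s)
      * (v i 0 * cos (omega * s) - w i 0 * sin (omega * s))) _ :=
  is_deriveM he (is_deriveB (is_deriveZ (v i 0) hc) (is_deriveZ (w i 0) hs)).
have -> : (fun s => (expR (sigma * s) *:
    (cos (omega * s) *: v - sin (omega * s) *: w)) i 0)
  = (fun s => expR (sigma * s)
      * (v i 0 * cos (omega * s) - w i 0 * sin (omega * s))).
  by apply/funext => s; rewrite !mxE; congr (_ * (_ - _)); exact: mulrC.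
apply: (is_derive_eq h).
rewrite scaler0 addr0 -scalemxAr mulmxBr -!scalemxAr Av Aw !mxE.
have ringE (E c s a b : R) : E * (a * (- s * omega) - b * (c * omega))
    + (a * c - b * s) * (E * sigma)
  = E * (c * (sigma * a - omega * b) - s * (omega * a + sigma * b)) by ring.
exact: ringE.
Qed.

(** The mode starting at [v] and the zero trajectory both have zero output, so their initial states
    agree. *)
Lemma observable_mode (R : realType) (n p : nat) (A : 'M[R]_n)
    (C : 'M[R]_(p, n)) (v w : 'cV[R]_n) (sigma omega : R) :
  observable C A ->
  A *m v = sigma *: v - omega *: w -> A *m w = omega *: v + sigma *: w ->
  C *m v = 0 -> C *m w = 0 -> v = 0.
Proof.
move=> [T T0 obs] Av Aw Cv Cw.
have := obs _ (fun=> 0) (trajectory_mode Av Aw).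
rewrite !mulr0 expR0 cos0 sin0 !scale1r scale0r subr0; apply.
  move=> t i; rewrite mulmx0 scaler0 addr0 mxE.
  exact: is_derive_cst.
by move=> t _; rewrite mulmx0 -scalemxAr mulmxBr -!scalemxAr Cv Cw !scaler0 subr0 scaler0.
Qed.

(** * Spans and dimension in arbitrary vector spaces *)

Section LinearSpan.
Variables (K : fieldType) (V : lmodType K).
Implicit Type S T : set V.

Lemma lspan_sub S : S `<=` lspan S.
Proof.
move=> x Sx; exists 1%N, (fun=> 1), (fun=> x).
by split=> //; rewrite big_ord1 scale1r.
Qed.

Lemma lspan0 S : lspan S 0.
Proof.
exists 0%N, (fun=> 0), (fun=> 0); split; first by case.
by rewrite big_ord0.
Qed.

Lemma lspanD S x y : lspan S x -> lspan S y -> lspan S (x + y).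
Proof.
move=> [m [c [e [Se ->]]]] [m' [c' [e' [Se' ->]]]].
pose cat (X : Type) (f : 'I_m -> X) g (i : 'I_(m + m')) :=
  match fintype.split i with inl j => f j | inr j => g j end.
exists (m + m')%N, (cat K c c'), (cat V e e'); split.
  by move=> i; rewrite /cat; case: fintype.splitP.
rewrite big_split_ord /cat; congr (_ + _); apply: eq_bigr => i _.
  by case: (unsplitK (inl i : 'I_m + 'I_m')) => ->.
by case: (unsplitK (inr i : 'I_m + 'I_m')) => ->.
Qed.

Lemma lspanZ S a x : lspan S x -> lspan S (a *: x).
Proof.
move=> [m [c [e [Se ->]]]]; exists m, (fun i => a * c i), e; split=> //.
by rewrite scaler_sumr; apply: eq_bigr => i _; rewrite scalerA.
Qed.

Lemma lspan_lincomb S m (c : 'I_m -> K) (e : 'I_m -> V) :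
  (forall i, lspan S (e i)) -> lspan S (\sum_(i < m) c i *: e i).
Proof.
move=> Se; apply: big_ind; [exact: lspan0|exact: lspanD|].
by move=> i _; exact/lspanZ/Se.
Qed.

Lemma lspan_min S T : S `<=` lspan T -> lspan S `<=` lspan T.
Proof.
by move=> ST x [m [c [e [Se ->]]]]; apply: lspan_lincomb => i; exact/ST/Se.
Qed.

End LinearSpan.

Lemma lspan_image (K : fieldType) (V W : lmodType K) (f : {linear V -> W})
    (S : set V) : lspan (f @` S) = f @` lspan S.
Proof.
rewrite eqEsubset; split=> [y [m [c [e [Se ->]]]]|_ [x [m [c [e [Se ->]]]] <-]].
  have [g gP] : {g : 'I_m -> V & forall i, S (g i) /\ f (g i) = e i}.
    by apply: (@choice _ _ (fun i v => S v /\ f v = e i)) => i; have [v] := Se i; exists v.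
  exists (\sum_(i < m) c i *: g i).
    by exists m, c, g; split=> // i; case: (gP i).
  rewrite linear_sum; apply: eq_bigr => i _.
  by rewrite linearZ; case: (gP i) => _ ->.
exists m, c, (f \o e); split=> [i|].
  by exists (e i).
by rewrite linear_sum; apply: eq_bigr => i _; rewrite linearZ.
Qed.

(** Carries the dimension count from polynomials over to transfer functions. *)
Lemma has_dim_image (K : fieldType) (V W : lmodType K) (f : {linear V -> W})
    (U : set V) (k : nat) :
  injective f -> has_dim U k -> has_dim (f @` U) k.
Proof.
move=> f_inj [e [e_free eU]]; exists (f \o e); split.
  move=> c c0; apply: e_free; apply: f_inj.
  rewrite linear0 linear_sum -[RHS]c0.
  by apply: eq_bigr => i _; rewrite linearZ.
by rewrite -eU -lspan_image image_comp.
Qed.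

(** * Spans of polynomials of bounded degree *)

Section PolynomialSpan.
Variable F : fieldType.
Implicit Types (a d q : {poly F}) (S : set {poly F}).

Lemma lspan_size_le S N :
  S `<=` [set q : {poly F} | (size q <= N)%N] -> lspan S `<=` [set q | (size q <= N)%N].
Proof.
move=> SN x [m [c [e [Se ->]]]] /=.
apply: (leq_trans (size_sum _ _ _)); apply/bigmax_leqP => i _.
exact: leq_trans (size_scale_leq _ _) (SN _ (Se i)).
Qed.

Lemma lspan_monom N :
  lspan (range (fun k : 'I_N => 'X^k : {poly F})) = [set q : {poly F} | (size q <= N)%N].
Proof.
rewrite eqEsubset; split.
  by apply: lspan_size_le => _ [k _ <-] /=; rewrite size_polyXn.
move=> q /= qN; exists N, (fun i => q`_i), (fun i => 'X^i).
split; first by move=> i; exists i.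
rewrite -poly_def; apply/polyP => i; rewrite coef_poly.
by case: ltnP => // Ni; rewrite nth_default// (leq_trans qN).
Qed.

Lemma monom_lin_indep N : lin_indep (fun k : 'I_N => 'X^k : {poly F}).
Proof.
move=> c c0 i; have := congr1 (fun q : {poly F} => q`_i) c0.
rewrite coef0 coef_sum (bigD1 i)//= coefZ coefXn eqxx mulr1 big1 ?addr0//.
by move=> j /negPf ji; rewrite coefZ coefXn eq_sym val_eqE ji mulr0.
Qed.

Lemma has_dim_size_le N : has_dim [set q : {poly F} | (size q <= N)%N] N.
Proof.
exists (fun k : 'I_N => 'X^k); split; first exact: monom_lin_indep.
exact: lspan_monom.
Qed.

Lemma lspan_mul_size_le S n (f q : {poly F}) :
  (forall r : 'I_n, S ('X^r * q)) -> (size f <= n)%N -> lspan S (f * q).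
Proof.
move=> Sq fn.
have -> : f * q = \sum_(r < n) f`_r *: ('X^r * q).
  under eq_bigr do rewrite scalerAl.
  rewrite -mulr_suml -poly_def; congr (_ * _); apply/polyP => i.
  by rewrite coef_poly; case: ltnP => // ni; rewrite nth_default// (leq_trans fn).
by apply: lspan_lincomb => r; apply: lspan_sub.
Qed.

(* Bezout: q = f * a + g * d, where g may be reduced modulo a. *)
Lemma lspan_coprimep a d S n :
  size a = n.+1 -> (size d <= n)%N -> coprimep a d ->
  (forall r : 'I_n, S ('X^r * a)) -> (forall r : 'I_n, S ('X^r * d)) ->
  [set q : {poly F} | (size q <= 2 * n)%N] `<=` lspan S.
Proof.
move=> sa sd cop Sa Sd q /= qn.
have a0 : a != 0 by rewrite -size_poly_gt0 sa.
have [[u w] /= uw] := Bezout_eq1_coprimepP _ _ cop.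
pose g := (q * w) %% a; pose f := (q * w) %/ a * d + q * u.
have qE : q = f * a + g * d.
  rewrite /f /g -[LHS]mulr1 -uw mulrDr.
  rewrite [q * (w * d)]mulrA [in LHS](divp_eq (q * w) a); ring.
have sg : (size g <= n)%N by rewrite -ltnS -sa ltn_modp.
(* The cofactor f has absorbed the quotient by a, so its size is not evident. It is read off
   [f * a = q - g * d], of size at most 2n, because multiplying a nonzero f by a adds exactly n to
   the size. *)
have sf : (size f <= n)%N.
  have [->|f0] := eqVneq f 0; first by rewrite size_poly0.
  have fa : f * a = q - g * d by rewrite qE addrK.
  have : (size (f * a)%R <= 2 * n)%N.
    rewrite fa (leq_trans (size_polyD _ _))// geq_max qn size_polyN.
    rewrite (leq_trans (size_polyMleq _ _))//.
    by rewrite (leq_trans (leq_pred _))// mul2n -addnn leq_add.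
  by rewrite size_mul// sa addnS /= mul2n -addnn leq_add2r.
rewrite qE; apply: lspanD; exact: lspan_mul_size_le.
Qed.

End PolynomialSpan.

(** * The numerator b(s) = adj(sI - A) B and its coefficient vectors *)

Section ResolventNumerator.
Variables (R : realType) (n : nat) (A : 'M[R]_n) (B : 'cV[R]_n).

Definition resolvent_num : 'cV[{poly R}]_n :=
  \adj (char_poly_mx A) *m map_mx polyC B.

Local Notation b := resolvent_num.

Lemma resolvent_num_mulmx :
  char_poly_mx A *m b = char_poly A *: map_mx polyC B.
Proof. by rewrite /b mulmxA mul_mx_adj mul_scalar_mx. Qed.

Lemma resolvent_numE i :
  'X * b i 0 = \sum_j (A i j)%:P * b j 0 + char_poly A * (B i 0)%:P.
Proof.
have := resolvent_num_mulmx.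
rewrite /char_poly_mx mulmxBl mul_scalar_mx => /matrixP/(_ i 0).
rewrite !mxE => /eqP; rewrite subr_eq addrC => /eqP ->.
by congr (_ + _); apply: eq_bigr => j _; rewrite mxE.
Qed.

Lemma dnumE (p : nat) (C : 'M[R]_(p, n)) i :
  dnum A B C i = \sum_j (C i j)%:P * b j 0.
Proof.
rewrite /dnum -mulmxA mxE.
by apply: eq_bigr => j _; rewrite !mxE.
Qed.

(** Comparison of the coefficients of ['X^k.+1] in s b = A b + a B. Read downward in k, this is the
    Faddeev-LeVerrier recursion applied to B. *)
Lemma coef_resolvent_num i k :
  (b i 0)`_k = \sum_j A i j * (b j 0)`_k.+1 + (char_poly A)`_k.+1 * B i 0.
Proof.
have := congr1 (fun q : {poly R} => q`_k.+1) (resolvent_numE i).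
rewrite coefXM/= => ->; rewrite coefD coefMC coef_sum.
by congr (_ + _); apply: eq_bigr => j _; rewrite coefCM.
Qed.

(** The recursion closes because s b has no constant term; unrolled, this is Cayley-Hamilton applied
    to B. *)
Lemma coef0_resolvent_num i :
  \sum_j A i j * (b j 0)`_0 + (char_poly A)`_0 * B i 0 = 0.
Proof.
have := congr1 (fun q : {poly R} => q`_0) (resolvent_numE i).
rewrite coefXM/= => /esym; rewrite coefD coefMC coef_sum => h; rewrite -[RHS]h.
by congr (_ + _); apply: eq_bigr => j _; rewrite coefCM.
Qed.

(** For k >= n the coefficient of a in the recursion is 0, so b_k = A b_(k+1); since b_k vanishes
    for large k, descent shows that it vanishes down to k = n. *)
Lemma size_resolvent_num i : (size (b i 0%R) <= n)%N.
Proof.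
pose N := \max_j size (b j 0%R).
have bN j k : (N <= k)%N -> (b j 0)`_k = 0.
  by move=> Nk; rewrite nth_default// (leq_trans _ Nk)// leq_bigmax.
have hz m j k : (n <= k)%N -> (N <= k + m)%N -> (b j 0)`_k = 0.
  elim: m j k => [|m IHm] j k nk; first by rewrite addn0; exact: bN.
  move=> Nkm; rewrite coef_resolvent_num big1 => [|l _].
    by rewrite [X in X * _]nth_default ?mul0r ?addr0// size_char_poly.
  by rewrite IHm ?mulr0// ?(leqW nk)// addSnnS.
by apply/leq_sizeP => k nk; apply: (hz N) => //; exact: leq_addl.
Qed.

Lemma lead_resolvent_num i : (b i 0)`_n.-1 = B i 0.
Proof.
have n0 : (0 < n)%N := leq_ltn_trans (leq0n i) (ltn_ord i).
rewrite coef_resolvent_num prednK// big1 => [|j _].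
  have := char_poly_monic A; rewrite monicE lead_coefE size_char_poly => /eqP ->.
  by rewrite add0r mul1r.
by rewrite nth_default ?mulr0// size_resolvent_num.
Qed.

Lemma size_dnum (p : nat) (C : 'M[R]_(p, n)) i : (size (dnum A B C i) <= n)%N.
Proof.
rewrite dnumE (leq_trans (size_sum _ _ _))//; apply/bigmax_leqP => j _.
by rewrite mul_polyC (leq_trans (size_scale_leq _ _))// size_resolvent_num.
Qed.

(* The columns of this matrix span an A-invariant subspace containing B. *)
Lemma resolvent_num_coef_unitmx :
  controllable A B -> \matrix_(i < n, k < n) (b i 0)`_k \in unitmx.
Proof.
move=> ctr; set M := \matrix_(i, k) _.
rewrite -row_free_unit -kermx_eq0; set K := kermx M.
(* [M] only records the coefficients k < n; the later ones are 0, so [K] annihilates them all. *)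
have Kb r k : \sum_i K r i * (b i 0)`_k = 0.
  have [kn|nk] := ltnP k n; last first.
    apply: big1 => i _; rewrite [X in _ * X]nth_default ?mulr0//.
    exact: leq_trans (size_resolvent_num i) nk.
  have /matrixP/(_ r (Ordinal kn)) := mulmx_ker M.
  rewrite !mxE => KM; rewrite -[RHS]KM.
  by apply: eq_bigr => i _; rewrite [M _ _]mxE.
have KB0 r : \sum_i K r i * B i 0 = 0.
  by rewrite -[RHS](Kb r n.-1); apply: eq_bigr => i _; rewrite lead_resolvent_num.
have KB : K *m B = 0 by apply/matrixP => r j; rewrite ord1 !mxE KB0.
have KAM : K *m A *m M = 0.
  apply/matrixP => r k; rewrite -mulmxA !mxE.
  (* The recursion solved for A b_k, with b_(-1) = 0: A b_k = b_(k-1) - a_k B. [K] annihilates both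
     terms. *)
  have AM i : (A *m M) i k
      = (if (k : nat) is k'.+1 then (b i 0)`_k' else 0) - (char_poly A)`_k * B i 0.
    rewrite mxE; under eq_bigr do rewrite [M _ _]mxE.
    case: (k : nat) => [|k'].
      by apply/eqP; rewrite sub0r -addr_eq0; apply/eqP; exact: coef0_resolvent_num.
    by rewrite [(b i 0)`_k']coef_resolvent_num addrK.
  under eq_bigr do rewrite AM mulrBr.
  rewrite sumrB [X in _ - X](_ : _ = 0) ?subr0; last first.
    under eq_bigr do rewrite mulrCA.
    by rewrite -mulr_sumr KB0 mulr0.
  by case: (k : nat) => [|k'] //; apply: big1 => i _; rewrite mulr0.
(* The rows of [K *m A] lie in the left kernel of [M], hence are combinations of the rows of [K];
   [D] collects the coefficients. *)
have /submxP[D KA] : (K *m A <= K)%MS by apply/sub_kermxP.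
by apply/eqP; exact: controllable_invariant ctr KA KB.
Qed.

End ResolventNumerator.

(** * Real and imaginary parts *)

Section ComplexParts.
Variable R : rcfType.
Implicit Types (c : R) (z : R[i]).

Lemma Re_sum (I : finType) (F : I -> R[i]) :
  complex.Re (\sum_i F i) = \sum_i complex.Re (F i).
Proof. by apply: (big_morph (@complex.Re R)) => // -[? ?] []. Qed.

Lemma Im_sum (I : finType) (F : I -> R[i]) :
  complex.Im (\sum_i F i) = \sum_i complex.Im (F i).
Proof. by apply: (big_morph (@complex.Im R)) => // -[? ?] []. Qed.

Lemma Re_realM c z : complex.Re (real_complex R c * z) = c * complex.Re z.
Proof. by case: z => x y /=; rewrite mul0r subr0. Qed.

Lemma Im_realM c z : complex.Im (real_complex R c * z) = c * complex.Im z.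
Proof. by case: z => x y /=; rewrite mul0r addr0. Qed.

Lemma Re_mul z1 z2 : complex.Re (z1 * z2)
  = complex.Re z1 * complex.Re z2 - complex.Im z1 * complex.Im z2.
Proof. by case: z1 z2 => x y []. Qed.

Lemma Im_mul z1 z2 : complex.Im (z1 * z2)
  = complex.Im z1 * complex.Re z2 + complex.Re z1 * complex.Im z2.
Proof. by case: z1 z2 => x y [] x' y' /=; rewrite addrC. Qed.

Lemma complex_eq0 z : complex.Re z = 0 -> complex.Im z = 0 -> z = 0.
Proof. by case: z => x y /= -> ->. Qed.

End ComplexParts.

(** * Common roots, and a combination of the d_i coprime to a *)

Lemma horner_map_sumC (R : realType) (I : finType) (c : I -> R)
    (q : I -> {poly R}) (z : R[i]) :
  (map_poly (real_complex R) (\sum_i (c i)%:P * q i)).[z]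
  = \sum_i real_complex R (c i) * (map_poly (real_complex R) (q i)).[z].
Proof.
rewrite rmorph_sum horner_sum; apply: eq_bigr => i _.
by rewrite rmorphM/= hornerM map_polyC hornerC.
Qed.

Lemma no_common_root (R : realType) (n p : nat) (A : 'M[R]_n) (B : 'cV[R]_n)
    (C : 'M[R]_(p, n)) (z : R[i]) :
  (0 < n)%N -> controllable A B -> observable C A ->
  root (map_poly (real_complex R) (char_poly A)) z ->
  exists i, ~~ root (map_poly (real_complex R) (dnum A B C i)) z.
Proof.
move=> n0 ctr obs /rootP az; apply: contrapT => d_root.
have dz i : (map_poly (real_complex R) (dnum A B C i)).[z] = 0.
  by apply/rootP; apply: contrapT => /negP diz; apply: d_root; exists i.
pose b := resolvent_num A B.
pose bz i := (map_poly (real_complex R) (b i 0)).[z].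
pose v : 'cV[R]_n := \col_i complex.Re (bz i).
pose w : 'cV[R]_n := \col_i complex.Im (bz i).
(* Evaluation of s b = A b + a B at z, where a vanishes. *)
have Abz i : \sum_j real_complex R (A i j) * bz j = z * bz i.
  have := congr1 (fun q => (map_poly (real_complex R) q).[z])
    (resolvent_numE A B i).
  rewrite /= rmorphD [in RHS]rmorphM !rmorphM/= hornerD !hornerM map_polyX hornerX.
  by rewrite az mul0r addr0 horner_map_sumC => <-.
have Cbz i : \sum_j real_complex R (C i j) * bz j = 0.
  by rewrite -horner_map_sumC -dnumE dz.
have Av : A *m v = complex.Re z *: v - complex.Im z *: w.
  apply/matrixP => i j; rewrite ord1 !mxE -Re_mul -Abz Re_sum.
  by apply: eq_bigr => k _; rewrite Re_realM mxE.
have Aw : A *m w = complex.Im z *: v + complex.Re z *: w.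
  apply/matrixP => i j; rewrite ord1 !mxE -Im_mul -Abz Im_sum.
  by apply: eq_bigr => k _; rewrite Im_realM mxE.
have Cv : C *m v = 0.
  apply/matrixP => i j; rewrite ord1 !mxE -[RHS]/(complex.Re 0) -(Cbz i) Re_sum.
  by apply: eq_bigr => k _; rewrite Re_realM mxE.
have Cw : C *m w = 0.
  apply/matrixP => i j; rewrite ord1 !mxE -[RHS]/(complex.Im 0) -(Cbz i) Im_sum.
  by apply: eq_bigr => k _; rewrite Im_realM mxE.
have v0 : v = 0 by exact: observable_mode obs Av Aw Cv Cw.
have w0 : w = 0.
  (* The same lemma applied to -i (v + i w) = w - i v, whose real part is w. *)
  apply: (@observable_mode _ _ _ A C w (- v) (complex.Re z) (complex.Im z)) => //.
  - by rewrite Aw scalerN opprK addrC.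
  - by rewrite mulmxN Av opprB scalerN.
  - by rewrite mulmxN Cv oppr0.
have bz0 i : bz i = 0.
  apply: complex_eq0.
    by have /matrixP/(_ i 0) := v0; rewrite !mxE.
  by have /matrixP/(_ i 0) := w0; rewrite !mxE.
(* Real parts of the powers of z turn b(z) = 0 into a real relation among the columns of the
   coefficient matrix. It is nontrivial, as entry 0 of c is 1, and contradicts invertibility. *)
pose c : 'cV[R]_n := \col_k complex.Re (z ^+ k).
have Mc : (\matrix_(i < n, k < n) (b i 0)`_k) *m c = 0.
  apply/matrixP => i j; rewrite ord1 !mxE -[RHS]/(complex.Re 0) -(bz0 i) /bz.
  rewrite (@horner_coef_wide _ n) ?size_map_poly ?size_resolvent_num// Re_sum.
  by apply: eq_bigr => k _; rewrite coef_map Re_realM !mxE.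
have /(congr1 (mulmx (invmx (\matrix_(i < n, k < n) (b i 0)`_k)))) := Mc.
rewrite mulKmx ?resolvent_num_coef_unitmx// mulmx0 => /matrixP/(_ (Ordinal n0) 0).
by rewrite !mxE expr0 => /eqP; rewrite oner_eq0.
Qed.

(* v = (1, t, t^2, ...): each root z of a rules out only finitely many t. *)
Lemma exists_coprimep_lincomb (R : rcfType) (p : nat) (a : {poly R})
    (d : 'I_p -> {poly R}) :
  a != 0 ->
  (forall z : R[i], root (map_poly (real_complex R) a) z ->
     exists i, ~~ root (map_poly (real_complex R) (d i)) z) ->
  exists v : 'cV[R]_p, coprimep a (\sum_(i < p) v i 0 *: d i).
Proof.
move=> a0 ad; pose phi : {rmorphism R -> R[i]} := real_complex R.
have [rs] := closed_field_poly_normal (map_poly phi a).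
set az := map_poly phi a => azE.
have az0 : az != 0 by rewrite map_poly_eq0.
have rsP z : (z \in rs) = root az z.
  by rewrite azE rootZ ?lead_coef_eq0// root_prod_XsubC.
(* A polynomial in the parameter t: its value at t is that of the combination of the d_i at z. It is
   nonzero when z is a root of a, as some coefficient d_i(z) is. *)
pose P z : {poly R[i]} := \sum_(i < p) (map_poly phi (d i)).[z] *: 'X^i.
pose Q := \prod_(z <- rs) P z.
have Q0 : Q != 0.
  rewrite prodf_seq_neq0; apply/allP => z; rewrite rsP => /ad[i diz] /=.
  apply: contra diz => /eqP P0; apply/rootP.
  exact: (monom_lin_indep P0 i).
(* The [size Q] distinct numbers 0, 1, ... cannot all be roots of Q. A natural t also casts to both
   [R] and [R[i]], so v is real. *)
have [t Qt] : exists t : nat, ~~ root Q t%:R.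
  apply/not_existsP => Qt.
  have := @max_poly_roots _ Q [seq k%:R | k <- iota 0 (size Q)] Q0.
  rewrite size_map size_iota ltnn => H; apply: notF; apply: H.
    by apply/allP => _ /mapP[k _ ->]; have := Qt k => /negP; rewrite negbK.
  by rewrite map_inj_uniq ?iota_uniq//; exact: mulrIn (oner_neq0 _).
exists (\col_i t%:R ^+ i).
(* Coprimality is tested over the complex numbers, where a gcd of size other than 1 has a root. *)
rewrite -(coprimep_map phi) /coprimep.
apply/negPn/negP => /closed_rootP[z].
rewrite root_gcd => /andP[]; rewrite -/az -rsP => zrs /rootP dz.
move: Qt; rewrite /root /Q horner_prod prodf_seq_eq0 => /hasPn/(_ z zrs)/= /negP; apply.
apply/eqP; rewrite -[RHS]dz rmorph_sum/= !horner_sum; apply: eq_bigr => i _.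
by rewrite mxE map_polyZ !hornerZ hornerXn rmorphXn rmorph_nat mulrC.
Qed.

(** * Transfer functions of the plant and of the filter *)

Lemma ratpoly_eq0 (F : fieldType) (q : {poly F}) : (ratpoly q == 0) = (q == 0).
Proof. exact: tofrac_eq0. Qed.

Lemma ratpoly_inj (F : fieldType) : injective (@ratpoly F).
Proof.
move=> q1 q2 q12; apply/eqP; rewrite -subr_eq0 -ratpoly_eq0.
by rewrite rmorphB/= q12 subrr.
Qed.

(** Reads (sI - A)^-1 B = b / q off a polynomial identity. It serves the plant, with q = a and b =
    adj(sI - A) B, and the filter, with q = Lambda and b = (1, s, ..., s^(n-1)). *)
Lemma invmx_char_poly_mx (F : fieldType) (n : nat) (A : 'M[F]_n)
    (b : 'cV[{poly F}]_n) (q : {poly F}) (B : 'cV[F]_n) :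
  q != 0 -> char_poly_mx A *m b = q *: map_mx polyC B ->
  invmx (map_mx (@ratpoly F) (char_poly_mx A)) *m map_mx (@ratconst F) B
  = (ratpoly q)^-1 *: map_mx (@ratpoly F) b.
Proof.
move=> q0 Abq; set M := map_mx _ (char_poly_mx A).
have Mu : M \in unitmx.
  rewrite unitmxE det_map_mx unitfE ratpoly_eq0.
  exact: monic_neq0 (char_poly_monic A).
have -> : map_mx (@ratconst F) B = (ratpoly q)^-1 *: (M *m map_mx (@ratpoly F) b).
  rewrite -map_mxM Abq map_mxZ scalerA mulVf ?ratpoly_eq0// scale1r.
  by apply/matrixP => i j; rewrite !mxE.
by rewrite -scalemxAr mulKmx.
Qed.

(** In every row but the last, s * s^i cancels against s^(i+1); the last row collects s^n + sum_j
    alpha_j s^j, which is the monic Lambda. *)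
Lemma filter_mx_resolvent (R : realType) (n : nat) (L : {poly R}) :
  L \is monic -> size L = n.+1 ->
  char_poly_mx (filter_mx n L) *m (\col_(r < n) 'X^r)
  = L *: map_mx polyC (filter_in R n).
Proof.
move=> Lm Ls; apply/matrixP => i j; rewrite ord1.
rewrite /char_poly_mx mulmxBl mul_scalar_mx !mxE -exprS.
under eq_bigr do rewrite !mxE.
have [iN|iN] := eqVneq i.+1 n.
  have LE : L = 'X^n + \sum_(j < n) L`_j *: 'X^j.
    rewrite -[LHS]coefK poly_def Ls big_ord_recr /= addrC; congr (_ + _).
    by move: Lm; rewrite monicE lead_coefE Ls => /eqP ->; rewrite scale1r.
  rewrite iN mulr1 [RHS]LE -sumrN; congr (_ + _); apply: eq_bigr => k _.
  by rewrite polyCN mulNr opprK mul_polyC.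
have iltn : (i.+1 < n)%N by rewrite ltn_neqAle iN ltn_ord.
rewrite mulr0 (bigD1 (Ordinal iltn))//= eqxx mul1r big1 ?addr0 ?subrr// => k.
by rewrite -val_eqE /= eq_sym => /negPf ->; rewrite mul0r.
Qed.

Lemma transfer_filter (R : realType) (n : nat) (L : {poly R}) (r : 'I_n) :
  L \is monic -> size L = n.+1 ->
  transfer (filter_mx n L) (filter_in R n) 1%:M r 0 = ratpoly 'X^r / ratpoly L.
Proof.
move=> Lm Ls; rewrite /transfer -mulmxA.
rewrite (invmx_char_poly_mx (monic_neq0 Lm) (filter_mx_resolvent Lm Ls)).
have -> : map_mx (@ratconst R) (1%:M : 'M[R]_n) = 1%:M.
  apply/matrixP => i j; rewrite !mxE /ratconst.
  by case: eqP => _; rewrite ?polyC1 ?polyC0 ?rmorph1 ?rmorph0.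
by rewrite mul1mx !mxE mulrC.
Qed.

Lemma transfer_dnum (R : realType) (n p : nat) (A : 'M[R]_n) (B : 'cV[R]_n)
    (C : 'M[R]_(p, n)) (i : 'I_p) :
  transfer A B C i 0 = ratpoly (dnum A B C i) / ratpoly (char_poly A).
Proof.
rewrite /transfer -mulmxA.
have := invmx_char_poly_mx (monic_neq0 (char_poly_monic A))
  (resolvent_num_mulmx A B).
move=> ->.
rewrite -scalemxAr mxE mulrC; congr (_ / _).
rewrite dnumE rmorph_sum mxE; apply: eq_bigr => j _.
by rewrite !mxE rmorphM.
Qed.

(** * The filtered vector over a common denominator *)

Section RatDiv.
Variables (F : fieldType) (q0 : {poly F}).

(** Used with [q0 = a * Lambda], it undoes the clearing of denominators; as an injective linear map
    it preserves spans and dimensions. *)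
Definition ratdiv (q : {poly F}) : ratfun F := ratpoly q / ratpoly q0.

Fact ratdiv_is_linear : linear ratdiv.
Proof.
by move=> c q1 q2; rewrite /ratdiv rmorphD mulrDl -mul_polyC rmorphM -mulrA.
Qed.

HB.instance Definition _ :=
  GRing.isLinear.Build F {poly F} (ratfun F) _ ratdiv ratdiv_is_linear.

Lemma ratdiv_inj : q0 != 0 -> injective ratdiv.
Proof.
move=> q00 q1 q2 /mulIf; rewrite invr_eq0 ratpoly_eq0 => /(_ q00).
exact: ratpoly_inj.
Qed.

End RatDiv.

Lemma range_zvec (R : realType) (n p : nat) (L : {poly R}) (A : 'M[R]_n)
    (B : 'cV[R]_n) (C : 'M[R]_(p, n)) :
  L \is monic -> size L = n.+1 ->
  range (fun k => zvec L A B C k 0)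
  = ratdiv (char_poly A * L) @` S_SIMO A B C.
Proof.
move=> Lm Ls; set f := ratdiv _.
have a0 : ratpoly (char_poly A) != 0.
  by rewrite ratpoly_eq0 (monic_neq0 (char_poly_monic A)).
have L0 : ratpoly L != 0 by rewrite ratpoly_eq0 monic_neq0.
(* Reduction to the denominator a Lambda: the first identity is for the outputs, the second for the
   input. The second does not involve x, hence the dummy 0 supplied for [zeta_u]. *)
have fracE (F : fieldType) (x y z w : F) : z != 0 -> w != 0 ->
    (x / z * (y / w) = y * x / (z * w)) /\ (y / w = y * z / (z * w)).
  by move=> z0 w0; split; [rewrite invfM; ring|field; rewrite z0 w0].
have zu (r : 'I_n) : zeta_u n L r 0 = f ('X^r * char_poly A).
  rewrite /zeta_u transfer_filter// /f /ratdiv !(rmorphM (@ratpoly R)).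
  by case: (fracE (ratfun R) 0 (ratpoly 'X^r) _ _ a0 L0).
have zy (i : 'I_p) (r : 'I_n) :
    zeta_y L A B C i r 0 = f ('X^r * dnum A B C i).
  rewrite /zeta_y mxE transfer_filter// transfer_dnum /f /ratdiv.
  rewrite !(rmorphM (@ratpoly R)).
  by case: (fracE (ratfun R) (ratpoly (dnum A B C i)) (ratpoly 'X^r) _ _ a0 L0).
rewrite eqEsubset; split=> [_ [k _ <-]|_ [q [[r ->]|[r [i ->]]] <-]].
- rewrite /zvec -[k]splitK; case: (fintype.split k) => [r|s] /=.
    by rewrite col_mxEu zu; exists ('X^r * char_poly A) => //; left; exists r.
  rewrite col_mxEd mxE zy; eexists; last by [].
  by right; eexists; eexists; reflexivity.
- by exists (lshift _ r) => //; rewrite /zvec col_mxEu zu.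
(* [tagnat.Rank i r] is the position of entry r of block i in the stacked column. *)
- exists (rshift n (tagnat.Rank i r)) => //; rewrite /zvec col_mxEd -zy.
  have := mxcolK (fun i => zeta_y L A B C i) i => /matrixP/(_ r 0) <-.
  by rewrite [RHS]mxE.
Qed.

(** * Both spans as the polynomials of degree less than 2n *)

Theorem theorem3p6 (R : realType) (n p : nat) (hn : (1 <= n)%N) (hp : (1 <= p)%N)
    (A : 'M[R]_n) (B : 'cV[R]_n) (C : 'M[R]_(p, n))
    (hAB : controllable A B) (hCA : observable C A) :
  (exists v : 'cV[R]_p,
     let dtilde := \sum_(i < p) v i 0 *: dnum A B C i in
     lspan (S_SIMO A B C) =
     lspan ([set q : {poly R} | exists r : 'I_n, q = 'X^r * char_poly A] `|`
            [set q : {poly R} | exists r : 'I_n, q = 'X^r * dtilde]))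
  /\ has_dim (lspan (S_SIMO A B C)) (2 * n)
  /\ (forall Lambda : {poly R},
        Lambda \is monic -> size Lambda = n.+1 -> hurwitz Lambda ->
        has_dim (lspan (range (fun k => zvec Lambda A B C k 0))) (2 * n)).
Proof.
set a := char_poly A; set SS := S_SIMO A B C.
have sa : size a = n.+1 by exact: size_char_poly.
have [v cop] : exists v : 'cV[R]_p,
    coprimep a (\sum_(i < p) v i 0 *: dnum A B C i).
  apply: exists_coprimep_lincomb; first exact: monic_neq0 (char_poly_monic A).
  by move=> z; apply: no_common_root.
set dt := \sum_(i < p) _ in cop.
have sdt : (size dt <= n)%N.
  rewrite (leq_trans (size_sum _ _ _))//; apply/bigmax_leqP => i _.
  exact: leq_trans (size_scale_leq _ _) (size_dnum A B C i).
have sXM (r : 'I_n) (q : {poly R}) :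
    (size q <= n.+1)%N -> (size ('X^r * q)%R <= 2 * n)%N.
  move=> sq; rewrite (leq_trans (size_polyMleq _ _))// size_polyXn addSn /=.
  by rewrite (leq_trans (leq_add (leqnn r) sq))// addnS -addSn mul2n -addnn leq_add2r.
have SS_sub : SS `<=` [set q : {poly R} | (size q <= 2 * n)%N].
  move=> _ [[r ->]|[r [i ->]]] /=; apply: sXM; first by rewrite sa.
  by rewrite (leq_trans (size_dnum A B C i)).
pose T : set {poly R} := [set q | exists r : 'I_n, q = 'X^r * a]
  `|` [set q | exists r : 'I_n, q = 'X^r * dt].
have TE : lspan T = [set q : {poly R} | (size q <= 2 * n)%N].
  rewrite eqEsubset; split.
    apply: lspan_size_le => _ [[r ->]|[r ->]] /=; apply: sXM; first by rewrite sa.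
    by rewrite (leq_trans sdt).
  by apply: (lspan_coprimep sa sdt cop) => r; [left|right]; exists r.
have T_sub : T `<=` lspan SS.
  move=> _ [[r ->]|[r ->]]; first by apply: lspan_sub; left; exists r.
  rewrite /dt mulr_sumr.
  under eq_bigr do rewrite -scalerAr.
  by apply: lspan_lincomb => i; apply: lspan_sub; right; exists r, i.
(* Sandwich: [SS] lies in the polynomials of size at most 2n, which equal [lspan T], and [T] lies in
   [lspan SS]. *)
have SSE : lspan SS = [set q : {poly R} | (size q <= 2 * n)%N].
  rewrite eqEsubset; split; first exact: lspan_size_le.
  by rewrite -TE; exact: lspan_min.
split; first by exists v; rewrite /= SSE -TE.
rewrite SSE; split; first exact: has_dim_size_le.
move=> L Lm Ls _; rewrite range_zvec// lspan_image SSE.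
apply: has_dim_image; last exact: has_dim_size_le.
apply: ratdiv_inj; apply: mulf_neq0; apply: monic_neq0 => //.
exact: char_poly_monic.
Qed.
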